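(* Let $q$ be a prime power, $e\ge 1$ an integer, $V$ a $(2e+1)$-dimensional vector space over $\mathrm{GF}(q)$, $H$ a hyperplane of $V$, and $\sigma$ a polarity of $H$. Let $\tilde{\Gamma}$ be the graph obtained by Godsil--McKay switching from the Grassmann graph $J_q(2e+1,e+1)$ (on the $(e+1)$-dimensional subspaces of $V$) with respect to the partition $$\{C_U\cup C_{\sigma(U)}\mid U \text{ an } e\text{-dimensional subspace of } H\}\cup\{D\}$$ of its vertex set, where $C_U$ is the set of $(e+1)$-dimensional subspaces $W$ of $V$ with $W\cap H=U$, and $D$ is the set of $(e+1)$-dimensional subspaces of $H$ ($D$ being the distinguished part of the switching). Then $\tilde{\Gamma}$ is isomorphic to the twisted Grassmann graph $\tilde{J}_q(2e+1,e)$.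
   Context: All graphs are simple and undirected; adjacency is between distinct vertices. For a finite-dimensional vector space $W$ over $\mathrm{GF}(q)$, write $\genfrac{[}{]}{0pt}{}{W}{k}$ for the set of $k$-dimensional subspaces of $W$. Grassmann graph: $J_q(2e+1,e+1)$ has vertex set $\genfrac{[}{]}{0pt}{}{V}{e+1}$, with $W_1,W_2$ adjacent iff $\dim (W_1\cap W_2)=e$. Twisted Grassmann graph: $\tilde{J}_q(2e+1,e)$ (with respect to the hyperplane $H$ of $V$) has vertex set $\mathcal{A}\cup\mathcal{B}$, where $\mathcal{A}=\{W\in\genfrac{[}{]}{0pt}{}{V}{e+1}\mid W\not\subset H\}$ and $\mathcal{B}=\genfrac{[}{]}{0pt}{}{H}{e-1}$. Distinct vertices $W_1,W_2$ are adjacent according to the following rule: if $W_1,W_2\in\mathcal{A}$, iff $\dim (W_1\cap W_2)=e$; if $W_1\in\mathcal{A}$ and $W_2\in\mathcal{B}$ (or with the roles exchanged), iff $W_1\supset W_2$ (respectively $W_2\supset W_1$); if $W_1,W_2\in\mathcal{B}$, iff $\dim (W_1\cap W_2)=e-2$. Polarity: a polarity $\sigma$ of $H$ is an inclusion-reversing permutation of the set of all subspaces of $H$ such that $\sigma^2$ is the identity. (Hence, since $\dim H=2e$, $\sigma$ permutes $\genfrac{[}{]}{0pt}{}{H}{e}$.) If $\sigma(U)=U$, then the part $C_U\cup C_{\sigma(U)}$ is just $C_U$; the parts for $U$ and $\sigma(U)$ coincide. Godsil--McKay switching: let $\Gamma$ be a graph with vertex set $X$ and let $\{C_1,\dots,C_t,D\}$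 be a partition of $X$ such that (i) $\{C_1,\dots,C_t\}$ is an equitable partition of the subgraph induced on $X\setminus D$, i.e. for all $i,j$ the number of neighbors in $C_i$ of a vertex $x\in C_j$ depends only on $i$ and $j$ and not on the choice of $x\in C_j$; and (ii) every $x\in D$ has either $0$, $\frac12|C_i|$ or $|C_i|$ neighbors in $C_i$, for every $i$. The graph obtained from $\Gamma$ by Godsil--McKay switching with respect to this partition is the graph on $X$ obtained by interchanging adjacency and nonadjacency between $x\in D$ and the vertices of $C_i$ whenever $x$ has exactly $\frac12|C_i|$ neighbors in $C_i$; all other adjacencies are unchanged. The partition in the claim satisfies (i) and (ii), with $D$ in the role of $D$ and the distinct sets $C_U\cup C_{\sigma(U)}$ in the role of $C_1,\dots,C_t$. *)

(* Defs.v *)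
From HB Require Import structures.
From mathcomp Require Import all_boot all_order all_algebra all_fingroup.

Set Implicit Arguments.
Unset Strict Implicit.
Unset Printing Implicit Defensive.

Local Open Scope nat_scope.

(* A subspace is stored as its canonical generating matrix, so over a finite
   field the subspaces of V form a finite type. *)
Section FiniteVspace.

Import VectorInternalTheory.

Variables (F : finFieldType) (V : vectType F).

HB.instance Definition _ := [Countable of {vspace V} by <:].
HB.instance Definition _ := [Finite of {vspace V} by <:].

End FiniteVspace.

Record sgraph := SGraph {
  vertex :> finType;
  adj : rel vertex;
  adj_sym : symmetric adj;
  adj_irr : irreflexive adj
}.

Definition isomorphic (G1 G2 : sgraph) : Prop :=
  exists2 f : G1 -> G2, bijective f & {mono f : x y / adj x y}.

Section GodsilMcKay.

Variables (G : sgraph) (P : {set {set G}}) (D : {set G}).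

Definition nbr_in (C : {set G}) (x : G) : nat := #|[set y in C | adj x y]|.

Definition equitable : Prop :=
  forall Ci Cj : {set G}, Ci \in P -> Cj \in P ->
  forall x y : G, x \in Cj -> y \in Cj -> nbr_in Ci x = nbr_in Ci y.

(* P is the set {C_1, ..., C_t}.  [partition] also requires the C_i to be
   nonempty. *)
Definition gm_partition : Prop :=
  [/\ partition P (~: D), equitable &
      forall (x : G) (C : {set G}), x \in D -> C \in P ->
        [\/ nbr_in C x = 0, 2 * nbr_in C x = #|C| | nbr_in C x = #|C|]].

Definition gm_toggled (x y : G) : bool :=
  [&& x \in D, y \notin D &
      [exists C in P, (y \in C) && (2 * nbr_in C x == #|C|)]].

Definition gm_adj (x y : G) : bool :=
  adj x y (+) (gm_toggled x y || gm_toggled y x).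

Lemma gm_adj_sym : symmetric gm_adj.
Proof. by move=> x y; rewrite /gm_adj adj_sym orbC. Qed.

Lemma gm_adj_irr : irreflexive gm_adj.
Proof. by move=> x; rewrite /gm_adj adj_irr /gm_toggled; case: (x \in D). Qed.

(* Meaningful as Godsil-McKay switching only under [gm_partition]. *)
Definition gm_switch : sgraph := SGraph gm_adj_sym gm_adj_irr.

End GodsilMcKay.

Section Grassmann.

Variables (F : finFieldType) (V : vectType F).
Implicit Types U W : {vspace V}.

Definition is_hyperplane (H : {vspace V}) : Prop := (\dim H).+1 = \dim {:V}.

Definition dim_subspace (k : nat) : finType := {W : {vspace V} | \dim W == k}.

Definition grassmann_adj (k : nat) (W1 W2 : dim_subspace k) : bool :=
  (W1 != W2) && ((\dim (val W1 :&: val W2)).+1 == k).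

Lemma grassmann_adj_sym k : symmetric (@grassmann_adj k).
Proof. by move=> x y; rewrite /grassmann_adj eq_sym capvC. Qed.

Lemma grassmann_adj_irr k : irreflexive (@grassmann_adj k).
Proof. by move=> x; rewrite /grassmann_adj eqxx. Qed.

Definition grassmann (k : nat) : sgraph :=
  SGraph (@grassmann_adj_sym k) (@grassmann_adj_irr k).

Section Twisted.

Variables (H : {vspace V}) (e : nat).

Definition twA W : bool := (\dim W == e.+1) && ~~ (W <= H)%VS.

(* [(\dim W).+1 == e] and [(_).+2 == e] below avoid truncated subtraction. *)
Definition twB W : bool := ((\dim W).+1 == e) && (W <= H)%VS.

Definition tw_vertex : finType := {W : {vspace V} | twA W || twB W}.

Definition tw_adj (x y : tw_vertex) : bool :=
  let W1 := val x in let W2 := val y in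
  (x != y) &&
  [|| [&& twA W1, twA W2 & \dim (W1 :&: W2) == e],
      [&& twA W1, twB W2 & (W2 <= W1)%VS],
      [&& twB W1, twA W2 & (W1 <= W2)%VS] |
      [&& twB W1, twB W2 & (\dim (W1 :&: W2)).+2 == e]].

Lemma tw_adj_sym : symmetric tw_adj.
Proof.
move=> x y; rewrite /tw_adj [in LHS]eq_sym [in LHS]capvC; congr (_ && _).
by case: (twA (val x)); case: (twA (val y)); case: (twB (val x));
  case: (twB (val y)); case: (val x <= val y)%VS; case: (val y <= val x)%VS;
  case: (_ == e); case: (_ == e).
Qed.

Lemma tw_adj_irr : irreflexive tw_adj.
Proof. by move=> x; rewrite /tw_adj eqxx. Qed.

Definition twisted_grassmann : sgraph := SGraph tw_adj_sym tw_adj_irr.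

End Twisted.

Definition subspace (H : {vspace V}) : finType := {U : {vspace V} | (U <= H)%VS}.

Definition is_polarity (H : {vspace V}) (sigma : {perm subspace H}) : Prop :=
  (forall U1 U2 : subspace H, (val U1 <= val U2)%VS ->
     (val (sigma U2) <= val (sigma U1))%VS) /\
  (forall U : subspace H, sigma (sigma U) = U).

Section Parts.

Variables (H : {vspace V}) (e : nat).

Definition partC (U : subspace H) : {set grassmann e.+1} :=
  [set W : grassmann e.+1 | (val W :&: H)%VS == val U].

Definition partD : {set grassmann e.+1} :=
  [set W : grassmann e.+1 | (val W <= H)%VS].

Definition polarity_parts (sigma : {perm subspace H}) :
    {set {set grassmann e.+1}} :=
  [set partC U :|: partC (sigma U) |
     U : subspace H in [pred U : subspace H | \dim (val U) == e]].

End Parts.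

End Grassmann.

(* Main.v *)
(** The isomorphism is the identity on the vertices not contained in [H] and
    [sigma] on [D].  For [W] in [D] and [W'] in [C_U], [W] and [W'] are adjacent
    in the Grassmann graph iff [U <= W], so the half case arises when exactly one
    of [U], [sigma U] lies in [W], and after switching the condition becomes
    [sigma U <= W], i.e. [sigma W <= U = W' :&: H], i.e. [sigma W <= W'].

    For equitability, every vector [w] outside [H] lies in exactly one member of
    [C_U], namely [U + <[w]>].  Counting these vectors shows that the number of
    neighbours in [C_U] of a vertex [W] outside [D] depends only on
    [\dim (U :&: W)], and [\dim (U :&: U1) = \dim (sigma U :&: sigma U1)] for
    subspaces of dimension [e]. *)

Require Import Defs.
From mathcomp Require Import all_boot all_order all_algebra all_fingroup.
From mathcomp Require Import finfield zify.
Import GRing.Theory.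

Set Implicit Arguments.
Unset Strict Implicit.
Unset Printing Implicit Defensive.

(** * Vector counts and neighbour counts relative to a hyperplane *)

Lemma card_mem_vspace (F : finFieldType) (V : vectType F) (U : {vspace V}) :
  #|[set w : finvect_type V | w \in U]| = #|F| ^ \dim U.
Proof.
(* [finvect_type V] carries its own [vectType] structure, convertible to that of
   [V] only once [V] is destructed. *)
case: V U => T cT U; rewrite cardsE.
exact: (@card_vspace F (finvect_type (Vector.Pack cT) : finType) cT U).
Qed.

Section Hyperplane.

Variables (F : finFieldType) (V : vectType F) (H : {vspace V}).
Hypothesis hH : is_hyperplane H.
Implicit Types U W : {vspace V}.

(** When [W] is not inside [H], the sum [W + H] strictly contains a hyperplane, so it is the whole
    space; the dimension formula does the rest. *)
Lemma dim_cap_hyperplane W : ~~ (W <= H)%VS -> (\dim (W :&: H)).+1 = \dim W.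
Proof.
move=> nWH; have := dimv_sum_cap W H; have := dimvS (subvf (W + H)).
have [leHWH] := dimv_leqif_sup (addvSr W H).
rewrite subv_add subvv andbT (negbTE nWH); move: hH; rewrite /is_hyperplane; lia.
Qed.

Lemma dim_add_line U w : \dim (U + <[w]>) = \dim U + (w \notin U).
Proof.
case: (boolP (w \in U)) => [wU | nwU] /=; first by rewrite (addv_idPl _) ?addn0.
rewrite dimv_disjoint_sum ?dim_vline; last first.
  apply/eqP; rewrite -subv0; apply/subvP => v /memv_capP[vU /vlineP[k vE]].
  move: vU; rewrite vE rpredZeq (negbTE nwU) orbF => /eqP ->.
  by rewrite GRing.scale0r mem0v.
by have [w0 | //] := eqVneq w 0%R; rewrite w0 mem0v in nwU.
Qed.

Lemma card_outside_hyperplane W : ~~ (W <= H)%VS ->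
  #|[set w : finvect_type V | (w \in W) && (w \notin H)]|
    = #|F| ^ \dim W - #|F| ^ (\dim W).-1.
Proof.
move=> nWH; have <- : \dim (W :&: H) = (\dim W).-1.
  by rewrite -(dim_cap_hyperplane nWH).
pose A U := [set w : finvect_type V | w \in U].
have -> : [set w : finvect_type V | (w \in W) && (w \notin H)] = A W :\: A H.
  by apply/setP => w; rewrite !inE andbC.
have AI : A (W :&: H)%VS = A W :&: A H.
  by apply/setP => w; rewrite in_setI !in_set; exact: memv_cap.
by rewrite -!card_mem_vspace -/(A W) -/(A _) AI -(cardsID (A H) (A W)) addKn.
Qed.

Lemma cap_add_line U w : (U <= H)%VS -> w \notin H ->
  ((U + <[w]>) :&: H)%VS = U.
Proof.
move=> UH nwH; have nUwH : ~~ (U + <[w]> <= H)%VS by rewrite subv_add UH.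
apply/esym/eqP; rewrite -dimv_leqif_eq ?subv_cap ?addvSl ?UH //.
rewrite -eqSS dim_cap_hyperplane // dim_add_line.
by rewrite (contra (subvP UH w) nwH) addn1.
Qed.

(** This identifies the fibre over [W] of the map sending [w] to [U + <[w]>]: it consists of the
    vectors of [W] outside [H]. *)
Lemma add_line_eq U W w : (W :&: H)%VS = U -> \dim W = (\dim U).+1 ->
  w \notin H -> ((U + <[w]>)%VS == W) = (w \in W).
Proof.
move=> WU dW nwH; apply/eqP/idP => [<- | wW].
  by apply: (subvP (addvSr _ _)); exact: memv_line.
apply/eqP; rewrite -dimv_leqif_eq; last first.
  by rewrite subv_add -WU capvSl.
by rewrite dW dim_add_line -WU memv_cap (negbTE nwH) andbF addn1.
Qed.

(** Double counting: [w] maps to [U + <[w]>] from the vectors outside [H] to [C_U], and every fibre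
    has [#|F| ^ e.+1 - #|F| ^ e] elements. The predicate [Q] is left free so that one count yields
    both part sizes and neighbour numbers. *)
Lemma card_partC (e : nat) (U : subspace H) (Q : pred {vspace V}) :
    \dim (val U) = e ->
  #|[set W in partC e U | Q (val W)]| * (#|F| ^ e.+1 - #|F| ^ e)
  = #|[set w : finvect_type V | (w \notin H) && Q (val U + <[w : V]>)%VS]|.
Proof.
move=> dU.
have dUw (w : V) : w \notin H ->
    (val U + <[w]>)%VS \in [pred W : {vspace V} | \dim W == e.+1].
  move=> nwH; rewrite inE dim_add_line dU (contra (subvP (valP U) w) nwH) addn1.
  exact: eqxx.
(* The vector [w0] only supplies the default value that makes [p] total; on vectors outside [H], [p]
   takes its intended value. *)
have /subvPn[w0 _ nw0H]: ~~ (fullv <= H)%VS.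
  by apply/negP => /dimvS; rewrite -hH ltnn.
pose p (w : V) : grassmann V e.+1 :=
  insubd (Sub (val U + <[w0]>)%VS (dUw w0 nw0H) : dim_subspace V e.+1)
    (val U + <[w]>)%VS.
have pE w : w \notin H -> val (p w) = (val U + <[w]>)%VS.
  by move=> nwH; rewrite /p; exact: (insubdK _ (dUw w nwH)).
rewrite -sum_nat_const -[RHS]sum1_card.
rewrite (partition_big (p : finvect_type V -> _)
  (mem [set W in partC e U | Q (val W)])).
  apply: eq_bigr => W; rewrite !inE => /andP[/eqP WU QW].
  have nWH : ~~ (val W <= H)%VS.
    apply/negP => /capv_idPl WH; have := valP W; rewrite /= -WH WU dU => /eqP; lia.
  have := card_outside_hyperplane nWH; rewrite (eqP (valP W)) => <-.
  rewrite -sum1_card; apply: eq_bigl => w; rewrite !inE.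
  have [wH | nwH] := boolP (w \in H); first by rewrite andbF.
  have eqW : (val U + <[w : V]> == val W)%VS = (w \in val W).
    by rewrite (add_line_eq WU) // dU (eqP (valP W)).
  rewrite -val_eqE [val (p w)]pE // eqW andbT.
  by case: eqP eqW => [-> <- | _ <-]; rewrite ?QW ?andbF.
move=> w; rewrite !inE => /andP[nwH Qw]; rewrite pE // Qw andbT.
by rewrite cap_add_line ?(valP U).
Qed.

Lemma grassmann_adjE (k : nat) (W1 W2 : dim_subspace V k.+1) :
  grassmann_adj W1 W2 = (\dim (val W1 :&: val W2) == k).
Proof.
rewrite /grassmann_adj eqSS; case: eqVneq => //= ->.
by rewrite capvv (eqP (valP W2)); lia.
Qed.

(** Comparing the dimension formulas for [U, W] and for [W, U + <[w]>]: the intersection gains a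
    dimension exactly when the sum does not grow. *)
Lemma dim_cap_add_line W U w : w \notin U ->
  \dim (W :&: (U + <[w]>)) = \dim (U :&: W) + (w \in (W + U)%VS).
Proof.
move=> nwU; have := dimv_sum_cap W (U + <[w]>); have := dimv_sum_cap U W.
rewrite addvA !dim_add_line nwU addvC.
by case: (w \in _) => /=; lia.
Qed.

Lemma expn_card_gap (k : nat) : 0 < #|F| ^ k.+1 - #|F| ^ k.
Proof. by rewrite subn_gt0 ltn_exp2l // finRing_gt1. Qed.

Lemma card_partC_eq (e : nat) (U1 U2 : subspace H) :
    \dim (val U1) = e -> \dim (val U2) = e ->
  #|partC e U1| = #|partC e U2|.
Proof.
have partCT (U : subspace H) : partC e U = [set W in partC e U | xpredT (val W)].
  by apply/setP => W; rewrite !inE andbT.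
move=> d1 d2; apply/eqP; rewrite -(eqn_pmul2r (expn_card_gap e)) partCT [partC e U2]partCT.
by rewrite !(@card_partC e _ xpredT).
Qed.

(** Neighbours are counted through the vectors [w] outside [H] that span them together with [U].
    Here [c] is the number of vectors of [W + U] outside [H], this sum having dimension
    [e.*2.+1 - d]. The intersection has dimension [d], plus one if [w] lies in [W + U], and it must
    equal [e]. *)
Lemma nbr_partC_mul (e : nat) (U : subspace H) (W : grassmann V e.+1)
    (d := \dim (val U :&: val W)) (c := #|F| ^ (e.*2.+1 - d) - #|F| ^ (e.*2 - d)) :
    \dim (val U) = e -> ~~ (val W <= H)%VS ->
  nbr_in (partC e U) W * (#|F| ^ e.+1 - #|F| ^ e)
    = if d == e then #|F| ^ \dim {:V} - #|F| ^ \dim H - c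
      else if d.+1 == e then c else 0.
Proof.
move=> dU nWH.
pose A := [set w : finvect_type V | (w \in {:V}%VS) && (w \notin H)].
pose B := [set w : finvect_type V | (w \in (val W + val U)%VS) && (w \notin H)].
have cA : #|A| = #|F| ^ \dim {:V} - #|F| ^ \dim H.
  rewrite card_outside_hyperplane -?hH //.
  by apply/negP => /dimvS; rewrite -hH ltnn.
have cB : #|B| = c.
  rewrite card_outside_hyperplane ?subv_add ?negb_and ?nWH //.
  have -> : \dim (val W + val U) = e.*2.+1 - d.
    have := dimv_sum_cap (val W) (val U); rewrite dU (eqP (valP W)) capvC -/d; lia.
  have : d <= e by rewrite -dU dimvS ?capvSl.
  rewrite /c => ?; congr (_ - _ ^ _); lia.
have -> : nbr_in (partC e U) W
    = #|[set W' in partC e U | (fun X => \dim (val W :&: X) == e) (val W')]|.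
  by apply: eq_card => W'; rewrite !inE /= grassmann_adjE.
rewrite (@card_partC e U (fun X => \dim (val W :&: X) == e)) // -cA -cB -(cardsID B A).
have -> : A :&: B = B.
  by apply/setP => w; rewrite !inE memvf; case: (w \in H); rewrite ?andbF ?andbT.
rewrite addKn.
have E (w : V) : w \notin H ->
    (\dim (val W :&: (val U + <[w]>)) == e) = (d + (w \in (val W + val U)%VS) == e).
  move=> nwH; rewrite dim_cap_add_line //.
  by apply: contra nwH => /(subvP (valP U)).
have -> : [set w : finvect_type V |
    (w \notin H) && (\dim (val W :&: (val U + <[w : V]>)) == e)]
  = [set w : finvect_type V | (w \notin H) && (d + (w \in (val W + val U)%VS) == e)].
  by apply/setP => w; rewrite !inE; case: (boolP (w \in H)) => //= /E ->.
(* If [d = e] the vectors wanted are those outside [W + U]; if [d.+1 = e] they are those inside it;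
   otherwise there are none. *)
case: eqVneq => [-> | nde].
  apply: eq_card => w; rewrite !inE memvf /=.
  by case: (w \in H) => //=; case: (w \in _) => /=; lia.
case: eqVneq => [de | nde'].
  apply: eq_card => w; rewrite !inE.
  by case: (w \in H); case: (w \in _) => //=; lia.
apply: eq_card0 => w; rewrite !inE.
by case: (w \in H); case: (w \in _) => //=; lia.
Qed.

(** The preceding formula sees [U] and [W] only through the dimension of their intersection, and the
    fibre size is positive, so it cancels. *)
Lemma nbr_partC_eq (e : nat) (U1 U2 : subspace H) (W1 W2 : grassmann V e.+1) :
    \dim (val U1) = e -> \dim (val U2) = e ->
    ~~ (val W1 <= H)%VS -> ~~ (val W2 <= H)%VS ->
    \dim (val U1 :&: val W1) = \dim (val U2 :&: val W2) ->
  nbr_in (partC e U1) W1 = nbr_in (partC e U2) W2.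
Proof.
move=> d1 d2 nW1 nW2 dUW; apply/eqP; rewrite -(eqn_pmul2r (expn_card_gap e)).
by rewrite !nbr_partC_mul // dUW.
Qed.

(** Since [x] lies in [H], its intersection with [y] is its intersection with [y :&: H = U], which
    has dimension [e] only if it is all of [U]. *)
Lemma adj_partC_sub (e : nat) (U : subspace H) (x y : grassmann V e.+1) :
    \dim (val U) = e -> (val x <= H)%VS -> y \in partC e U ->
  adj x y = (val U <= val x)%VS.
Proof.
move=> dU xH; rewrite inE => /eqP yU; rewrite /= grassmann_adjE.
rewrite -(capv_idPl xH) -capvA [(H :&: _)%VS]capvC yU capvC.
have -> : (\dim (val U :&: val x) == e) = (\dim (val U :&: val x) == \dim (val U)).
  by rewrite dU.
rewrite dimv_leqif_eq ?capvSl //; apply/eqP/idP => [<- | /capv_idPl //].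
exact: capvSr.
Qed.

Lemma nbr_partC_sub (e : nat) (U : subspace H) (x : grassmann V e.+1) :
    \dim (val U) = e -> (val x <= H)%VS ->
  nbr_in (partC e U) x = (val U <= val x)%VS * #|partC e U|.
Proof.
move=> dU xH; have adjx := adj_partC_sub dU xH.
rewrite /nbr_in; case: (boolP (val U <= val x)%VS) => Ux.
  rewrite mul1n; apply: eq_card => y; rewrite in_set.
  by case: (boolP (y \in _)) => // /adjx ->.
apply: eq_card0 => y; rewrite in_set.
by case: (boolP (y \in _)) => // /adjx ->; apply: negbTE.
Qed.

End Hyperplane.

(** * Effect of a polarity on dimensions, intersections and sums *)

Section Polarity.

Variables (F : finFieldType) (V : vectType F) (H : {vspace V}).
Variables (sigma : {perm subspace H}).
Hypothesis hsigma : is_polarity sigma.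
Implicit Types A B C : subspace H.

Lemma polarityK : involutive sigma.
Proof. by case: hsigma. Qed.

Lemma polarity_anti A B : (val (sigma B) <= val (sigma A))%VS = (val A <= val B)%VS.
Proof.
have [anti K] := hsigma; apply/idP/idP => [/anti|]; first by rewrite !K.
exact: anti.
Qed.

Lemma polarity_dim_lt A B : (val A <= val B)%VS -> \dim (val A) < \dim (val B) ->
  \dim (val (sigma B)) < \dim (val (sigma A)).
Proof.
move=> AB; have sAB : (val (sigma B) <= val (sigma A))%VS by rewrite polarity_anti.
by rewrite !(ltn_leqif (dimv_leqif_sup _)) // polarity_anti.
Qed.

(** Strict inclusions are reversed, so lowering [A] by one dimension raises [sigma A] by at least
    one. Descending from [A] to the zero space gives one inequality, ascending from [A] to [H] the
    other; no bilinear form is involved. *)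
Lemma dim_polarity A : \dim (val (sigma A)) + \dim (val A) = \dim H.
Proof.
apply/eqP; rewrite eqn_leq; apply/andP; split.
  have [k] := ubnP (\dim (val A)); elim: k A => // k IH A lek.
  have [A0 | A0] := eqVneq (\dim (val A)) 0.
    by rewrite A0 addn0 dimvS ?(valP (sigma A)).
  have vA0 : vpick (val A) != 0%R by rewrite vpick0 -dimv_eq0.
  (* A complement in [A] of the line through a nonzero vector, hence one dimension smaller. *)
  pose B0 := (val A :\: <[vpick (val A)]>)%VS.
  have B0A : (B0 <= val A)%VS by exact: diffvSl.
  have dB : (\dim B0).+1 = \dim (val A).
    rewrite -(dimv_cap_compl (val A) <[vpick (val A)]>).
    by rewrite (capv_idPr _) ?dim_vline ?vA0 // -memvE memv_pick.
  pose B : subspace H := Sub B0 (subv_trans B0A (valP A)).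
  have : \dim (val B) < \dim (val A) by rewrite -dB.
  have BA : (val B <= val A)%VS by exact: diffvSl.
  move/(polarity_dim_lt BA); have : \dim (val B) < k by rewrite /= -/B0; lia.
  by move/IH; rewrite [val B]/= -/B0; lia.
have [k] := ubnP (\dim H - \dim (val A)); elim: k A => // k IH A lek.
have [HA | /subvPn[w wH nwA]] := boolP (H <= val A)%VS.
  by rewrite (leq_trans (dimvS HA)) // leq_addl.
pose B0 := (val A + <[w]>)%VS.
have B0H : (B0 <= H)%VS by rewrite subv_add (valP A) -memvE.
have dB : \dim B0 = (\dim (val A)).+1 by rewrite dim_add_line nwA addn1.
pose B : subspace H := Sub B0 B0H.
have : \dim (val A) < \dim (val B) by rewrite [val B]/= -/B0 dB.
have AB : (val A <= val B)%VS by exact: addvSl.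
move/(polarity_dim_lt AB).
have := dimvS B0H; have : \dim H - \dim (val B) < k.
  by rewrite [val B]/= -/B0; have := dimvS B0H; lia.
by move/IH; rewrite [val B]/= -/B0; lia.
Qed.

(** An inclusion-reversing involution exchanges meets and joins: with [T] the sum, [sigma T] lies in
    both [A] and [B], hence in [C], so [sigma C] lies in [T]. *)
Lemma polarity_cap A B C : val C = (val A :&: val B)%VS ->
  val (sigma C) = (val (sigma A) + val (sigma B))%VS.
Proof.
move=> CE; apply/eqP; rewrite eqEsubv; apply/andP; split; last first.
  by rewrite subv_add !polarity_anti CE capvSl capvSr.
have TH : (val (sigma A) + val (sigma B) <= H)%VS.
  by rewrite subv_add (valP (sigma A)) (valP (sigma B)).
pose T : subspace H := Sub (val (sigma A) + val (sigma B))%VS TH.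
rewrite -[(_ + _)%VS]/(val T) -[T]polarityK polarity_anti CE subv_cap.
by apply/andP; split; rewrite -[X in (_ <= val X)%VS]polarityK polarity_anti
  ?addvSl ?addvSr.
Qed.

(** The complementary dimension of the intersection is that of [sigma A + sigma B]. The additive
    form avoids truncated subtraction. It serves in dimension [e], where the intersection dimension
    is preserved, and in dimension [e.+1], where it drops by two. *)
Lemma dim_cap_polarity A B :
  \dim (val A :&: val B) + \dim H
  = \dim (val (sigma A) :&: val (sigma B)) + (\dim (val A) + \dim (val B)).
Proof.
have CH : (val A :&: val B <= H)%VS by rewrite (subv_trans (capvSl _ _)) ?(valP A).
pose C : subspace H := Sub (val A :&: val B)%VS CH.
have := dim_polarity C; rewrite (@polarity_cap A B C erefl) [val C]SubK.
have := dimv_sum_cap (val (sigma A)) (val (sigma B)).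
have := dim_polarity A; have := dim_polarity B; lia.
Qed.

End Polarity.

(** * The parts [C_U :|: C_(sigma U)] and the Godsil-McKay conditions *)

Section Switching.

Variables (F : finFieldType) (V : vectType F) (H : {vspace V}) (e : nat).
Variables (sigma : {perm subspace H}).
Hypothesis hH : is_hyperplane H.
Hypothesis dH : \dim H = e.*2.
Hypothesis hsigma : is_polarity sigma.
Implicit Types U : subspace H.
Implicit Types x y : grassmann V e.+1.

Local Notation part U := (partC e U :|: partC e (sigma U)).

Lemma dim_polarity_mid U : \dim (val U) = e -> \dim (val (sigma U)) = e.
Proof. by have := dim_polarity hsigma U; lia. Qed.

Lemma mem_partC U x : (x \in partC e U) = (val x :&: H == val U)%VS.
Proof. by rewrite inE. Qed.

Lemma partC_nsub U x : \dim (val U) = e -> x \in partC e U -> ~~ (val x <= H)%VS.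
Proof.
move=> dU; rewrite mem_partC => /eqP xU; apply/negP => /capv_idPl xH.
by have := valP x; rewrite /= -xH xU dU => /eqP; lia.
Qed.

Lemma partC_inj U1 U2 x : x \in partC e U1 -> x \in partC e U2 -> U1 = U2.
Proof. by rewrite !mem_partC => /eqP -> /eqP/val_inj. Qed.

Lemma polarity_partsP (C : {set grassmann V e.+1}) :
  reflect (exists2 U, \dim (val U) = e & C = part U) (C \in polarity_parts e sigma).
Proof.
apply: (iffP imsetP) => -[U dU ->]; exists U => //; first exact/eqP.
by rewrite inE; apply/eqP.
Qed.

Lemma part_polarity U : part (sigma U) = part U.
Proof. by rewrite polarityK // setUC. Qed.

(** A part has the two indices [U] and [sigma U], so the index may be chosen to be the trace of [x]
    on [H]. *)
Lemma mem_part_eq U x : \dim (val U) = e -> x \in part U ->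
  exists2 U', [/\ \dim (val U') = e & x \in partC e U'] & part U' = part U.
Proof.
move=> dU; rewrite inE => /orP[xU | xU]; first by exists U.
exists (sigma U); first by split=> //; exact: dim_polarity_mid.
exact: part_polarity.
Qed.

(** The two halves are disjoint unless [U = sigma U]; the boolean factor then prevents counting the
    single half twice. *)
Lemma nbr_part U x : nbr_in (part U) x
  = nbr_in (partC e U) x + (U != sigma U) * nbr_in (partC e (sigma U)) x.
Proof.
case: eqVneq => [<- | nU]; first by rewrite setUid addn0.
rewrite mul1n /nbr_in -cardsUI [X in _ + X](_ : _ = 0) ?addn0.
  by apply: eq_card => y; rewrite !in_set; case: (adj x y); rewrite ?andbT ?andbF.
apply: eq_card0 => y; rewrite in_setI !(in_set (fun _ => _ && _)).
apply/negP => /andP[/andP[yU _] /andP[ysU _]].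
by case/eqP: nU; exact: partC_inj yU ysU.
Qed.

Lemma card_part U : \dim (val U) = e ->
  #|part U| = #|partC e U| + (U != sigma U) * #|partC e U|.
Proof.
move=> dU; case: eqVneq => [<- | nU]; first by rewrite setUid addn0.
rewrite mul1n [X in _ + X](card_partC_eq hH dU (dim_polarity_mid dU)).
rewrite -cardsUI [X in _ = _ + X](_ : _ = 0) ?addn0 //.
apply: eq_card0 => y; rewrite in_setI; apply/negP => /andP[yU ysU].
by case/eqP: nU; exact: partC_inj yU ysU.
Qed.

Lemma dim_cap_polarity_mid U U' : \dim (val U) = e -> \dim (val U') = e ->
  \dim (val U :&: val U') = \dim (val (sigma U) :&: val (sigma U')).
Proof. by move=> dU dU'; have := dim_cap_polarity hsigma U U'; lia. Qed.

Lemma cap_partC U U' x : x \in partC e U' -> (val U :&: val x = val U :&: val U')%VS.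
Proof.
by rewrite mem_partC => /eqP <-; rewrite [(val x :&: _)%VS]capvC capvA (capv_idPl (valP U)).
Qed.

(** If [y] is in the same half as [x], the two summands agree one by one; if it is in the other
    half, [sigma] preserves the intersection dimensions and the summands trade places. *)
Lemma nbr_part_partC U U1 x y : \dim (val U) = e -> \dim (val U1) = e ->
  x \in partC e U1 -> y \in part U1 -> nbr_in (part U) x = nbr_in (part U) y.
Proof.
move=> dU dU1 xU1; have dsU := dim_polarity_mid dU.
have dsU1 := dim_polarity_mid dU1; rewrite !nbr_part.
have nx := partC_nsub dU1 xU1.
rewrite inE => /orP[yU1 | yU1].
  have ny := partC_nsub dU1 yU1.
  by congr (_ + _ * _); apply: nbr_partC_eq => //;
    rewrite !(cap_partC _ xU1, cap_partC _ yU1).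
have ny := partC_nsub dsU1 yU1.
have E1 : nbr_in (partC e U) x = nbr_in (partC e (sigma U)) y.
  apply: nbr_partC_eq => //; rewrite (cap_partC _ xU1) (cap_partC _ yU1).
  exact: dim_cap_polarity_mid.
have E2 : nbr_in (partC e (sigma U)) x = nbr_in (partC e U) y.
  apply: nbr_partC_eq => //; rewrite (cap_partC _ xU1) (cap_partC _ yU1).
  by rewrite dim_cap_polarity_mid // polarityK.
rewrite E1 E2; case: eqVneq => [<- | _] //.
by rewrite !mul1n addnC.
Qed.

Lemma polarity_parts_equitable : equitable (polarity_parts e sigma).
Proof.
move=> _ _ /polarity_partsP[U dU ->] /polarity_partsP[U1 dU1 ->] x y xU1 yU1.
have [U2 [dU2 xU2] E] := mem_part_eq dU1 xU1.
by apply: (nbr_part_partC dU dU2 xU2); rewrite E.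
Qed.

Lemma partC_neq0 U : \dim (val U) = e -> partC e U != set0.
Proof.
move=> dU; have /subvPn[w _ nwH]: ~~ (fullv <= H)%VS.
  by apply/negP => /dimvS; rewrite -hH ltnn.
have dUw : \dim (val U + <[w]>) == e.+1.
  by rewrite dim_add_line dU (contra (subvP (valP U) w) nwH) addn1.
apply/set0Pn; exists (Sub (val U + <[w]>)%VS dUw : dim_subspace V e.+1).
by rewrite mem_partC SubK cap_add_line ?(valP U).
Qed.

Lemma mem_own_partC x : ~~ (val x <= H)%VS ->
  exists2 U : subspace H, \dim (val U) = e & x \in partC e U.
Proof.
move=> nxH; pose U : subspace H := Sub (val x :&: H)%VS (capvSr (val x) H).
exists U; last by rewrite mem_partC SubK.
rewrite SubK; have := dim_cap_hyperplane hH nxH; rewrite (eqP (valP x)); lia.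
Qed.

Lemma polarity_parts_partition : partition (polarity_parts e sigma) (~: partD H e).
Proof.
apply/and3P; split.
- rewrite eqEsubset; apply/andP; split; apply/subsetP => x.
    case/bigcupP=> _ /polarity_partsP[U dU ->] /(mem_part_eq dU)[U' [dU' xU'] _].
    by rewrite !inE (partC_nsub dU' xU').
  rewrite !inE => /mem_own_partC[U dU xU]; apply/bigcupP.
  exists (part U); last by rewrite inE xU.
  by apply/polarity_partsP; exists U.
- apply/trivIsetP => _ _ /polarity_partsP[U1 dU1 ->] /polarity_partsP[U2 dU2 ->].
  (* Two parts sharing [x] can both be reindexed by the trace of [x] on [H], so they coincide. *)
  apply: contraNT => /pred0Pn[x /andP[/= /(mem_part_eq dU1)[U1' [_ x1] <-]]].
  move=> /(mem_part_eq dU2)[U2' [_ x2] <-].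
  by rewrite (partC_inj x1 x2).
apply/negP => /polarity_partsP[U dU /esym/eqP].
by rewrite setU_eq0 (negbTE (partC_neq0 dU)).
Qed.

Lemma nbr_part_sub U x : \dim (val U) = e -> (val x <= H)%VS ->
  nbr_in (part U) x = ((val U <= val x)%VS + (U != sigma U) * (val (sigma U) <= val x)%VS)
    * #|partC e U|.
Proof.
move=> dU xH; have dsU := dim_polarity_mid dU.
by rewrite nbr_part !nbr_partC_sub // (card_partC_eq hH dsU dU) mulnDl mulnA.
Qed.

Lemma polarity_gm_partition : gm_partition (polarity_parts e sigma) (partD H e).
Proof.
split; [exact: polarity_parts_partition | exact: polarity_parts_equitable |].
move=> x _ xD /polarity_partsP[U dU ->]; have xH : (val x <= H)%VS by move: xD; rewrite inE.
(* A self-polar [U] gives none or all of the part; otherwise none, half or all, according to how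
   many of [U] and [sigma U] lie in [x]. *)
rewrite nbr_part_sub // card_part //; case: eqVneq => _;
  case: (val U <= val x)%VS; case: (val (sigma U) <= val x)%VS;
  rewrite ?mul0n ?mul1n ?addn0 ?add0n ?mul0n ?mul1n ?mul2n -?addnn;
  by [constructor 1 | constructor 2 | constructor 3].
Qed.

Lemma gm_toggledE U x y : \dim (val U) = e -> (val x <= H)%VS -> y \in partC e U ->
  gm_toggled (polarity_parts e sigma) (partD H e) x y
    = ((val U <= val x) (+) (val (sigma U) <= val x))%VS.
Proof.
move=> dU xH yU; rewrite /gm_toggled !inE xH (partC_nsub dU yU) /=.
(* Nonemptiness keeps the half case distinct from the none and all cases. *)
have N0 : 0 < #|partC e U| by rewrite lt0n cards_eq0 partC_neq0.
have -> : (val U <= val x)%VS (+) (val (sigma U) <= val x)%VS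
   = (2 * nbr_in (part U) x == #|part U|).
  rewrite nbr_part_sub // card_part //; case: (eqVneq U (sigma U)) => [<- | _];
  case: (val U <= val x)%VS; case: (val (sigma U) <= val x)%VS;
  by move: #|_| N0 => N N0 /=; lia.
apply/existsP/idP => [[C /and3P[/polarity_partsP[U' dU' ->] yU' E]] | E].
  have [U2 [_ yU2] E2] := mem_part_eq dU' yU'.
  by rewrite (partC_inj yU yU2) E2.
exists (part U); rewrite inE yU E andbT /= andbT.
by apply/polarity_partsP; exists U.
Qed.

(** * The isomorphism onto the twisted Grassmann graph *)

(* The identity branch serves the vertices outside [D]: [swap] is the whole
   isomorphism, and its own inverse. *)
Definition swap (W : {vspace V}) : {vspace V} :=
  if insub W is Some U then val (sigma U) else W.

Lemma swap_in U : swap (val U) = val (sigma U).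
Proof. by rewrite /swap valK. Qed.

Lemma swap_out W : ~~ (W <= H)%VS -> swap W = W.
Proof. by move=> nWH; rewrite /swap insubN. Qed.

Lemma swapK : involutive swap.
Proof.
move=> W; rewrite {2}/swap; case: insubP => [U _ <- | nWH]; last exact: swap_out.
by rewrite swap_in polarityK.
Qed.

Lemma twA_swap x : twA H e (swap (val x)) = ~~ (val x <= H)%VS.
Proof.
rewrite /twA; have [xH | nxH] := boolP (val x <= H)%VS; last first.
  by rewrite swap_out // (valP x) nxH.
by rewrite -[val x](SubK (subspace H) xH) swap_in (valP (sigma _)) andbF.
Qed.

(** As [\dim H = e.*2], [sigma] takes dimension [e.+1] to [e.-1], so [D] lands among the vertices of
    the second type. *)
Lemma twB_swap x : twB H e (swap (val x)) = (val x <= H)%VS.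
Proof.
rewrite /twB; have [xH | nxH] := boolP (val x <= H)%VS; last first.
  by rewrite swap_out // (negbTE nxH) andbF.
pose U : subspace H := Sub (val x) xH.
rewrite -[val x]/(val U) swap_in (valP (sigma U)) andbT.
have := dim_polarity hsigma U; rewrite dH [val U]SubK (eqP (valP x)); lia.
Qed.

Lemma dim_swap_tw (y : tw_vertex H e) : \dim (swap (val y)) == e.+1.
Proof.
case/orP: (valP y) => /andP[/eqP dy yH]; first by rewrite swap_out ?dy.
pose U : subspace H := Sub (val y) yH.
rewrite -[val y]/(val U) swap_in.
have := dim_polarity hsigma U; rewrite dH [val U]SubK; lia.
Qed.

Lemma sub_swap U x : (val x <= H)%VS ->
  (swap (val x) <= val U)%VS = (val (sigma U) <= val x)%VS.
Proof.
move=> xH; rewrite -[val x](SubK (subspace H) xH) swap_in.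
by rewrite -[U in LHS](polarityK hsigma) polarity_anti.
Qed.

Lemma gm_adj_sub_nsub x y : (val x <= H)%VS -> ~~ (val y <= H)%VS ->
  gm_adj (polarity_parts e sigma) (partD H e) x y = (swap (val x) <= val y)%VS.
Proof.
move=> xH nyH; have [U dU yU] := mem_own_partC nyH.
rewrite /gm_adj (gm_toggledE dU xH yU) (adj_partC_sub dU xH yU).
(* The original adjacency [U <= x] cancels against the same term of the toggle, leaving
   [sigma U <= x]. *)
rewrite /gm_toggled !inE (negbTE nyH) orbF addbA addbb addFb -sub_swap //.
move: yU; rewrite mem_partC => /eqP <-; rewrite subv_cap.
have -> : (swap (val x) <= H)%VS by have := twB_swap x; rewrite xH => /andP[].
by rewrite andbT.
Qed.

(** Switching only alters pairs with exactly one member in [D]. *)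
Lemma gm_adj_same_side x y : (val x <= H)%VS = (val y <= H)%VS ->
  gm_adj (polarity_parts e sigma) (partD H e) x y = (\dim (val x :&: val y) == e).
Proof.
move=> xyH; rewrite /gm_adj [adj x y]grassmann_adjE /gm_toggled !inE xyH.
by case: (val y <= H)%VS; rewrite /= addbF.
Qed.

Lemma dim_cap_swap x y : (val x <= H)%VS -> (val y <= H)%VS ->
  ((\dim (swap (val x) :&: swap (val y))).+2 == e) = (\dim (val x :&: val y) == e).
Proof.
move=> xH yH; pose X : subspace H := Sub (val x) xH; pose Y : subspace H := Sub (val y) yH.
rewrite -[val x]/(val X) -[val y]/(val Y) !swap_in.
have := dim_cap_polarity hsigma X Y.
have -> : \dim (val X) = e.+1 by apply/eqP/(valP x).
have -> : \dim (val Y) = e.+1 by apply/eqP/(valP y).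
rewrite dH; lia.
Qed.

Lemma polarity_gm_iso :
  isomorphic (gm_switch (polarity_parts e sigma) (partD H e)) (twisted_grassmann H e).
Proof.
have fP x : twA H e (swap (val x)) || twB H e (swap (val x)).
  by rewrite twA_swap twB_swap orNb.
pose f x : tw_vertex H e := Sub (swap (val x)) (fP x).
pose g (y : tw_vertex H e) : dim_subspace V e.+1 := Sub (swap (val y)) (dim_swap_tw y).
have fK : cancel f g by move=> x; apply: val_inj; rewrite !SubK swapK.
exists f; first by exists g => // y; apply: val_inj; rewrite !SubK swapK.
have mixed x y : (val x <= H)%VS -> ~~ (val y <= H)%VS ->
    tw_adj (f x) (f y) = gm_adj (polarity_parts e sigma) (partD H e) x y.
  move=> xH nyH; rewrite gm_adj_sub_nsub // /tw_adj !SubK !twA_swap !twB_swap.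
  rewrite xH nyH (negbTE nyH) /= !orbF (swap_out nyH) (can_eq fK).
  (* Distinctness is automatic, as only one of the two vertices lies in [H]. *)
  by case: eqVneq nyH => // <-; rewrite xH.
move=> x y; change (tw_adj (f x) (f y) = gm_adj (polarity_parts e sigma) (partD H e) x y).
have [xH | nxH] := boolP (val x <= H)%VS; have [yH | nyH] := boolP (val y <= H)%VS.
- rewrite gm_adj_same_side ?xH ?yH // /tw_adj !SubK !twA_swap !twB_swap xH yH /=.
  rewrite dim_cap_swap // (can_eq fK).
  (* The dimension condition already excludes [x = y], where the intersection has dimension
     [e.+1]. *)
  by case: eqVneq => //= <-; rewrite capvv (eqP (valP x)); lia.
- exact: mixed.
- by rewrite tw_adj_sym mixed // gm_adj_sym.
rewrite gm_adj_same_side ?(negbTE nxH) ?(negbTE nyH) // /tw_adj !SubK !twA_swap !twB_swap.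
rewrite (negbTE nxH) (negbTE nyH) /= !orbF !swap_out // (can_eq fK).
by case: eqVneq => //= <-; rewrite capvv (eqP (valP x)); lia.
Qed.

End Switching.

Theorem theorem3 (q : nat) (F : finFieldType) (hq : #|F| = q)
    (e : nat) (he : 1 <= e)
    (V : vectType F) (hV : \dim {:V} = 2 * e + 1)
    (H : {vspace V}) (hH : is_hyperplane H)
    (sigma : {perm (subspace H)}) (hsigma : is_polarity sigma) :
  gm_partition (polarity_parts e sigma) (partD H e) /\
  isomorphic (gm_switch (polarity_parts e sigma) (partD H e))
             (twisted_grassmann H e).
Proof.
have dH : \dim H = e.*2 by move: hH; rewrite /is_hyperplane hV; lia.
by split; [exact: polarity_gm_partition | exact: polarity_gm_iso].
Qed.
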